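(* For every graph $\Gamma$, every subgroup $G$ of $\operatorname{Aut}(\Gamma)$, every $\lambda\in\mathbb{N}$ and every $\mu\in\{0,\dots,\lambda\}$, we have $$OP_{\Gamma,G}(\lambda,\mu)=\frac{1}{|G|}\sum_{g\in G}P_{\Gamma/g}(\lambda,\mu).$$ In particular, $OP_{\Gamma,G}(\lambda,\mu)$ is a polynomial in $\lambda$ and $\mu$ (that is, for fixed $\Gamma$ and $G$ the function $(\lambda,\mu)\mapsto OP_{\Gamma,G}(\lambda,\mu)$ is given by a polynomial in two variables).
   Context: $\mathbb{N}$ denotes the positive integers. Graphs are finite and undirected and may contain loops and multiple edges. $\operatorname{Aut}(\Gamma)$ is the group of automorphisms of $\Gamma$, viewed as permutations of the vertex set. A $\lambda$-coloring of $\Gamma$ is a map $f$ from the vertex set of $\Gamma$ to $\{1,\dots,\lambda\}$. For $\mu\in\{0,\dots,\lambda\}$, $f$ is $\mu$-proper if for every pair of adjacent vertices $v,w$ of $\Gamma$, either $f(v)\ne f(w)$ or $f(v)=f(w)>\mu$ (a vertex with a loop is adjacent to itself, so it must get a color $>\mu$). The bivariate chromatic polynomial $P_\Gamma(\lambda,\mu)$ is the number of $\mu$-proper $\lambda$-colorings of $\Gamma$. $OP_{\Gamma,G}(\lambda,\mu)$ is defined as the number of equivalence classes of $\mu$-proper $\lambda$-colorings of $\Gamma$ under the action of $G$, where $f$ and $f'$ are equivalent if $f'=f\circ g$ for some $g\in G$. For a permutation $g$ of the vertex set of $\Gamma$, $\Gamma/g$ denotes the graph obtained from $\Gamma$ by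 identifying, for each cycle of the disjoint cycle decomposition of $g$ (fixed points being cycles of length one), all vertices in that cycle to a single vertex (edges between identified vertices become loops), and then replacing parallel edges by single edges. *)

(* Defs.v *)
From HB Require Import structures.
From mathcomp Require Import all_boot all_order all_algebra all_fingroup.

Set Implicit Arguments.
Unset Strict Implicit.
Unset Printing Implicit Defensive.

(* Undirected graphs with loops and multiple edges: an edge e has one endpoint
   (a loop) or two, and distinct edges may have the same set of endpoints. *)
Record mgraph := MGraph {
  vertex : finType;
  edge : finType;
  ends : edge -> {set vertex};
  ends_card : forall e, 0 < #|ends e| <= 2
}.

Section Graph.

Variable Gm : mgraph.
Local Notation V := (vertex Gm).

(* adjacent v v holds exactly when v carries a loop, since [set v; v] = [set v]. *)
Definition adjacent (v w : V) : bool := [exists e, @ends Gm e == [set v; w]].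

(* A vertex permutation is an automorphism when it is induced by an
   incidence-preserving pair of permutations of vertices and edges, i.e. when
   it preserves the number of edges between any two vertices. *)
Definition graph_aut_set : {set {perm V}} :=
  [set g : {perm V} | [exists h : {perm edge Gm},
     [forall e, ends (h e) == g @: ends e]]].

Lemma graph_aut_group_set : group_set graph_aut_set.
Proof.
apply/group_setP; split.
  rewrite inE; apply/existsP; exists 1%g; apply/forallP => e.
  by rewrite perm1 -[X in X == _]imset_id; apply/eqP/eq_imset => v; rewrite perm1.
move=> g1 g2; rewrite !inE => /existsP[h1 /forallP H1] /existsP[h2 /forallP H2].
apply/existsP; exists (h1 * h2)%g; apply/forallP => e.
rewrite permM (eqP (H2 _)) (eqP (H1 _)) -imset_comp.
by apply/eqP/eq_imset => v /=; rewrite permM.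
Qed.

Canonical graph_aut : {group {perm V}} := Group graph_aut_group_set.

(* The ordinal i < l stands for the color i.+1, so colors range over 1, ..., l. *)
Definition color (l : nat) (i : 'I_l) : nat := i.+1.

Definition coloring (l : nat) : finType := {ffun V -> 'I_l}.

Definition mu_proper (l m : nat) (f : coloring l) : bool :=
  [forall v, forall w, adjacent v w ==>
     (f v != f w) || ((f v == f w) && (m < color (f v)))].

Definition proper_colorings (l m : nat) : {set coloring l} :=
  [set f | mu_proper m f].

Definition bichrom (l m : nat) : nat := #|proper_colorings l m|.

Definition coloring_equiv (G : {set {perm V}}) (l : nat) : rel (coloring l) :=
  fun f f' => [exists g in G, f' == [ffun v => f (g v)]].

Definition orbital_bichrom (G : {set {perm V}}) (l m : nat) : nat :=
  #|equivalence_partition (@coloring_equiv G l) (proper_colorings l m)|.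

End Graph.

Section Quotient.

Variables (Gm : mgraph) (g : {perm vertex Gm}).

Definition cycle_type : finType := {C : {set vertex Gm} | C \in porbits g}.

Lemma porbit_in_porbits (v : vertex Gm) : porbit g v \in porbits g.
Proof. exact: imset_f. Qed.

Definition cycle_of (v : vertex Gm) : cycle_type :=
  exist _ (porbit g v) (porbit_in_porbits v).

Lemma identify_ends_card (e : edge Gm) : 0 < #|cycle_of @: ends e| <= 2.
Proof.
have /andP[e0 e2] := ends_card e; rewrite (leq_trans (leq_imset_card _ _) e2).
case/card_gt0P: e0 => v ve; rewrite andbT; apply/card_gt0P.
by exists (cycle_of v); apply: imset_f.
Qed.

Definition identify_cycles : mgraph := MGraph identify_ends_card.

End Quotient.

Section Simplify.

Variable Gm : mgraph.

Definition edge_class : finType :=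
  {A : {set vertex Gm} | A \in codom (@ends Gm)}.

Lemma simplify_ends_card (A : edge_class) : 0 < #|val A| <= 2.
Proof. by case: A => A /= /codomP[e ->]; apply: ends_card. Qed.

(* Parallel edges are merged: there is one edge for each set of endpoints that
   occurs. Loops are kept. *)
Definition merge_parallel : mgraph := MGraph simplify_ends_card.

End Simplify.

Definition quotient_graph (Gm : mgraph) (g : {perm vertex Gm}) : mgraph :=
  merge_parallel (identify_cycles g).

(* Main.v *)
(* The first identity is Burnside's lemma: G acts on the mu-proper colorings, and a
   coloring fixed by g is one that is constant on the cycles of g, i.e. a coloring of
   Gm / g.  A coloring fails to be mu-proper exactly when some edge is spoiled, meaning
   that its endpoints share a color <= mu, so the mu-proper colorings can be counted by
   inclusion-exclusion over the sets J of edges required to be spoiled.  A coloring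
   spoiling J amounts to one color per connected component of J, among mu colors if the
   component contains an edge of J and among lambda colors otherwise.  Hence every
   bivariate chromatic polynomial, and so the average of those of the graphs Gm / g, is
   a polynomial. *)
Require Import Defs.
From HB Require Import structures.
From mathcomp Require Import all_boot all_order all_algebra all_fingroup.

Set Implicit Arguments.
Unset Strict Implicit.
Unset Printing Implicit Defensive.

Import GRing.Theory.
Local Open Scope ring_scope.

(** * Spoiled edges and proper colorings *)

(** Color indices start at 0, so [f v < m] means a color of at most [m]. The case [v = w] keeps this
    bound for a loop. *)
Definition spoiled (V : finType) (l m : nat) (f : V -> 'I_l) (A : {set V}) : bool :=
  [forall v in A, forall w in A, (f v == f w) && (f v < m)%N].

Lemma spoiledP (V : finType) (l m : nat) (f : V -> 'I_l) (A : {set V}) :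
  reflect {in A &, forall v w, f v = f w /\ (f v < m)%N} (spoiled m f A).
Proof.
apply: (iffP forall_inP) => [H v w vA wA | H v vA].
  by have /forall_inP/(_ w wA)/andP[/eqP] := H v vA.
by apply/forall_inP => w wA; have [-> ->] := H v w vA wA; rewrite eqxx.
Qed.

Lemma spoiled_imset (V W : finType) (h : V -> W) (l m : nat) (f : W -> 'I_l)
    (A : {set V}) :
  spoiled m f (h @: A) = spoiled m (f \o h) A.
Proof.
apply/spoiledP/spoiledP => H.
  by move=> v w vA wA; apply: H; apply: imset_f.
by move=> _ _ /imsetP[v vA ->] /imsetP[w wA ->]; apply: H.
Qed.

Lemma eq_spoiled (V : finType) (l m : nat) (f f' : V -> 'I_l) (A : {set V}) :
  f =1 f' -> spoiled m f A = spoiled m f' A.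
Proof.
by move=> ff'; apply: eq_forallb => v; congr (_ ==> _); apply: eq_forallb => w;
  rewrite !ff'.
Qed.

Lemma ends_pair (Gm : mgraph) (e : edge Gm) :
  exists v w, ends e = [set v; w].
Proof.
have /andP[e0 e2] := ends_card e.
case/card_gt0P: e0 => v ve; move: e2; rewrite (cardsD1 v) ve ltnS => le1.
have [e0 | [w we]] := set_0Vmem (ends e :\ v).
  by exists v, v; rewrite -(setD1K ve) e0 setU0 setUid.
exists v, w; rewrite -(setD1K ve); congr (_ :|: _); apply/eqP.
by rewrite eq_sym eqEcard sub1set we cards1.
Qed.

Lemma mu_properE (Gm : mgraph) (l m : nat) (f : coloring Gm l) :
  mu_proper m f = [forall e : edge Gm, ~~ spoiled m f (ends e)].
Proof.
apply/forallP/forallP => [H e | H v].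
  have [v [w evw]] := ends_pair e; apply/negP; rewrite evw => /spoiledP S.
  have [fvw ltm] := S v w (set21 v w) (set22 v w).
  have /forallP/(_ w)/implyP := H v.
  rewrite fvw eqxx /= /color ltnS leqNgt -fvw ltm; move=> F.
  by apply/notF/F/existsP; exists e; rewrite evw.
apply/forallP => w; apply/implyP => /existsP[e /eqP evw].
have [fvw /=|//] := eqVneq; rewrite /color ltnS leqNgt.
apply: contra (H e) => ltm; rewrite evw; apply/spoiledP.
by move=> x y /set2P[]-> /set2P[]->; rewrite -?fvw.
Qed.

(** * Counting the colorings that spoil a given set of edges *)

Section Count.

Variables (Gm : mgraph) (J : {set edge Gm}).
Local Notation V := (vertex Gm).

Let linked : rel V := fun v w => [exists e in J, (v \in ends e) && (w \in ends e)].

Let linked_sym : connect_sym linked.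
Proof.
by apply: sym_connect_sym => v w; apply: eq_existsb => e; rewrite (andbC (v \in _)).
Qed.

(** Separates the components containing an edge of [J], possibly just a loop, from the vertices on
    no edge of [J]. *)
Let touched (v : V) : bool := [exists e in J, exists w in ends e, connect linked v w].

Let spoil_edge e v w : e \in J -> v \in ends e -> w \in ends e -> linked v w.
Proof. by move=> eJ ve we; apply/existsP; exists e; rewrite eJ ve. Qed.

Let spoiling l m : {set coloring Gm l} :=
  [set f : coloring Gm l | [forall e in J, spoiled m f (ends e)]].

(** Equality of colors propagates along paths of edges in [J], so comparing each vertex with the
    root of its component suffices. *)
Let spoilingP l m (f : coloring Gm l) :
  reflect ((forall v, f (fingraph.root linked v) = f v) /\ (forall v, touched v -> (f v < m)%N))
          (f \in spoiling l m).
Proof.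
rewrite inE; apply: (iffP forall_inP) => [H | [Hr Ht] e eJ].
  have Hc v w : connect linked v w -> f v = f w.
    case/connectP => p + ->; elim: p v => [//|x p IHp] v /= /andP[/exists_inP[e eJ]].
    case/andP=> ve xe /IHp <-.
    by have /spoiledP/(_ v x ve xe)[] := H e eJ.
  split=> v; first by rewrite -(Hc v) ?connect_root.
  case/exists_inP=> e eJ /exists_inP[w we] /Hc ->.
  by have /spoiledP/(_ w w we we)[] := H e eJ.
apply/spoiledP => v w ve we; split.
  rewrite -(Hr v) -(Hr w); congr (f _); apply/(fingraph.rootP linked_sym).
  exact/connect1/(spoil_edge eJ).
by apply: Ht; apply/exists_inP; exists e => //; apply/exists_inP; exists v.
Qed.

Let touched_root v : touched (fingraph.root linked v) = touched v.
Proof.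
apply: eq_existsb => e; congr (_ && _); apply: eq_existsb => w; congr (_ && _).
by rewrite -(same_connect linked_sym (connect_root linked v)).
Qed.

(* On the roots of the components the colors are free; pinning the other vertices to a
   junk color turns the count into that of a product of sets. *)
Let allowed l m (c0 : 'I_l) (v : V) : pred 'I_l :=
  if roots linked v then (if touched v then [pred i : 'I_l | (i < m)%N] else predT)
  else pred1 c0.

Let spread l (g : coloring Gm l) : coloring Gm l := [ffun v => g (fingraph.root linked v)].

Let spoiling_imset l m (c0 : 'I_l) :
  spoiling l m = spread (l := l) @: [set g in family (allowed m c0)].
Proof.
apply/setP => f; apply/spoilingP/imsetP => [[Hr Ht] | [g]].
  exists [ffun v => if roots linked v then f v else c0]; last first.
    by apply/ffunP => v; rewrite !ffunE roots_root.
  rewrite inE; apply/familyP => v; rewrite ffunE /allowed.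
  case: ifP => rv; last by rewrite !inE.
  by case: ifP => tv //; rewrite !inE Ht.
rewrite inE => /familyP Hg ->; split=> v; first by rewrite !ffunE root_root.
rewrite -touched_root ffunE => tv; have := Hg (fingraph.root linked v).
by rewrite /allowed roots_root // tv.
Qed.

Let spread_inj l m (c0 : 'I_l) :
  {in [set g in family (allowed m c0)] &, injective (spread (l := l))}.
Proof.
move=> g g'; rewrite !inE => /familyP Hg /familyP Hg' /ffunP E.
apply/ffunP => v; have [rv|rv] := boolP (roots linked v).
  by have := E v; rewrite !ffunE (eqP rv).
have := Hg v; have := Hg' v; rewrite /allowed (negPf rv) !inE.
by move=> /eqP-> /eqP->.
Qed.

(** The exponents count untouched and touched components through their roots, and depend on [J]
    alone. [0 < l] supplies the junk color; [m <= l] makes exactly [m] indices lie below [m]. *)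
Lemma card_spoiling :
  exists a b : nat, forall l m : nat, (0 < l)%N -> (m <= l)%N ->
    #|[set f : coloring Gm l | [forall e in J, spoiled m f (ends e)]]|
      = (l ^ a * m ^ b)%N.
Proof.
exists #|[pred v | roots linked v & ~~ touched v]|.
exists #|[pred v | roots linked v & touched v]|.
case=> // l m _ lml; rewrite -/(spoiling l.+1 m).
rewrite (spoiling_imset m ord0) card_in_imset; last exact: spread_inj.
rewrite cardsE card_family foldrE big_map big_enum /=.
rewrite (bigID (fun v => roots linked v)) /= [X in (_ * X)%N]big1 ?muln1; last first.
  by move=> v /negPf rv; rewrite /allowed rv card1.
rewrite (bigID touched) /= mulnC; congr (_ * _)%N.
  rewrite (eq_bigr (fun=> l.+1)) ?prod_nat_const // => v /andP[rv /negPf tv].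
  by rewrite /allowed rv tv card_ord.
rewrite (eq_bigr (fun=> m)) ?prod_nat_const // => v /andP[rv tv].
rewrite /allowed rv tv -sum1_card.
by rewrite -(big_ord_widen l.+1 (fun=> 1%N) lml) sum1_card card_ord.
Qed.

End Count.

(** * Inclusion-exclusion and polynomiality *)

Lemma bichrom_inclusion_exclusion (Gm : mgraph) (l m : nat) :
  (bichrom Gm l m)%:R
    = \sum_(J : {set edge Gm}) (-1) ^+ #|J|
        * #|[set f : coloring Gm l | [forall e in J, spoiled m f (ends e)]]|%:R :> rat.
Proof.
rewrite /bichrom -sum1_card natr_sum big_mkcond /=.
under eq_bigr => f _.
  (* The indicator of properness is a product over the edges of one minus the indicator of being
     spoiled; [bigA_distr] expands it over edge sets [J]. *)
  have -> : (if f \in proper_colorings Gm l m then 1%:R else 0)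
      = \prod_(e : edge Gm) (- (spoiled m f (ends e))%:R + 1) :> rat.
    rewrite inE mu_properE; case: ifPn => [/forallP H|].
      by rewrite big1 // => e _; rewrite (negPf (H e)) oppr0 add0r.
    rewrite negb_forall => /existsP[e]; rewrite negbK => S.
    by rewrite (bigD1 e) //= S addNr mul0r.
  rewrite bigA_distr; over.
rewrite exchange_big /=; apply: eq_bigr => J _.
rewrite -[X in X%:R]sum1_card natr_sum mulr_sumr [RHS]big_mkcond /=; apply: eq_bigr => f _.
rewrite -big_mkcond /= inE; case: ifPn => [/forall_inP H|].
  rewrite mulr1 -prodr_const; apply: eq_bigr => e eJ; by rewrite H.
rewrite negb_forall_in => /exists_inP[e eJ /negPf S].
by rewrite (bigD1 e) //= S oppr0 mul0r.
Qed.

Lemma bichrom_polynomial (Gm : mgraph) :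
  exists p : {poly {poly rat}}, forall l m : nat, (0 < l)%N -> (m <= l)%N ->
    (bichrom Gm l m)%:R = p.[l%:R, m%:R] :> rat.
Proof.
have /fin_all_exists[a /fin_all_exists[b Hab]] := @card_spoiling Gm.
(* The outer variable is evaluated at [l], the inner one, in the coefficients, at [m]. *)
exists (\sum_(J : {set edge Gm}) ((-1) ^+ #|J| * 'X^(b J))%:P * 'X^(a J)) => l m l0 lml.
rewrite bichrom_inclusion_exclusion !horner_sum; apply: eq_bigr => J _.
rewrite Hab // natrM !natrX !hornerM !hornerXn !hornerC !hornerM !horner_exp.
by rewrite hornerN !hornerC hornerX mulrAC mulrA.
Qed.

(** * Burnside's lemma for colorings *)

Section Orbits.

Variable Gm : mgraph.
Local Notation V := (vertex Gm).

Lemma card_fixed_colorings (g : {perm V}) (l m : nat) :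
  #|[set f in proper_colorings Gm l m | [forall v, f (g v) == f v]]|
    = bichrom (quotient_graph g) l m.
Proof.
pose lift (F : coloring (quotient_graph g) l) : coloring Gm l :=
  [ffun v => F (cycle_of g v)].
(* [s] picks one vertex in each cycle; composing with [s] inverts [lift] on colorings constant on
   cycles. *)
have /fin_all_exists[s sK] (C : cycle_type g) : exists v, cycle_of g v = C.
  by case: C => C CP; have /imsetP[v _ Cv] := CP; exists v; apply: val_inj.
have lift_inj : injective lift.
  by move=> F F' /ffunP E; apply/ffunP => C; have := E (s C); rewrite !ffunE sK.
(* Merging parallel edges is harmless, since being spoiled depends only on the set of endpoints. *)
have lift_proper F : mu_proper m (lift F) = mu_proper m F.
  have spoilE (e : edge Gm) :
      spoiled m F (cycle_of g @: ends e) = spoiled m (lift F) (ends e).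
    by rewrite spoiled_imset; apply: eq_spoiled => v; rewrite /= ffunE.
  rewrite !mu_properE; apply/forallP/forallP => H.
    by case=> A AP; rewrite [ends _]/=; have /codomP[e ->] := AP; rewrite spoilE.
  move=> e; rewrite -spoilE.
  exact: (H (exist (fun A => A \in codom (@ends (identify_cycles g))) _ (codom_f _ e))).
rewrite /bichrom -[RHS](card_imset _ lift_inj); apply: eq_card => f.
rewrite !inE; apply/andP/imsetP => [[pf /forallP fix_f] | [F]].
  have f_cycle v w : porbit g v = porbit g w -> f v = f w.
    move/eqP; rewrite eq_porbit_mem => /porbitP[i ->].
    elim: i => [|i IHi]; first by rewrite perm1.
    by rewrite expgSr permM (eqP (fix_f _)).
  have liftK : lift [ffun C => f (s C)] = f.
    by apply/ffunP => v; rewrite !ffunE; apply/f_cycle/(congr1 val (sK _)).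
  by exists [ffun C => f (s C)]; rewrite // inE -lift_proper liftK.
rewrite inE -lift_proper => pF ->; split=> //; apply/forallP => v.
rewrite !ffunE; apply/eqP; congr (F _); apply: val_inj => /=.
by apply/eqP; rewrite eq_porbit_mem -{1}[g]expg1 mem_porbit.
Qed.

(** The inverse makes this a right action, as permutations are multiplied from left to right. *)
Definition recolor l (f : coloring Gm l) (g : {perm V}) : coloring Gm l :=
  [ffun v => f ((g^-1)%g v)].

Lemma recolor1 l : (@recolor l)^~ 1%g =1 id.
Proof. by move=> f; apply/ffunP => v; rewrite ffunE invg1 perm1. Qed.

Lemma recolorM l (f : coloring Gm l) : act_morph (@recolor l) f.
Proof. by move=> g h; apply/ffunP => v; rewrite !ffunE invMg permM. Qed.

Definition recolor_action l := TotalAction (@recolor1 l) (@recolorM l).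

(** The edge permutation [h] inducing [g] carries the edges spoiled by [f] to those spoiled by
    [recolor f g]. *)
Lemma mu_proper_recolor l m (f : coloring Gm l) (g : {perm V}) :
  g \in graph_aut Gm -> mu_proper m (recolor f g) = mu_proper m f.
Proof.
rewrite inE => /existsP[h /forallP gh].
have spoilE e : spoiled m (recolor f g) (ends (h e)) = spoiled m f (ends e).
  by rewrite (eqP (gh e)) spoiled_imset; apply: eq_spoiled => v; rewrite /= ffunE permK.
rewrite !mu_properE; apply/forallP/forallP => H e; first by rewrite -spoilE.
by rewrite -(permKV h e) spoilE.
Qed.

Variables (G : {group {perm V}}) (hG : G \subset graph_aut Gm).

Lemma recolor_acts l m : [acts G, on proper_colorings Gm l m | recolor_action l].
Proof.
by apply/actsP => g /(subsetP hG) gA f; rewrite !inE mu_proper_recolor.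
Qed.

(** Since [G] is closed under inverses, the classes are orbits, and orbits of proper colorings
    contain only proper ones. *)
Lemma orbital_bichromE l m :
  orbital_bichrom G l m = #|orbit (recolor_action l) G @: proper_colorings Gm l m|.
Proof.
congr #|pred_of_set _|; apply: eq_in_imset => f fP; apply/setP => f'.
rewrite inE; apply/andP/orbitP => [[_ /exists_inP[g gG /eqP ->]] | [g gG <-]].
  by exists (g^-1)%g; rewrite ?groupV //; apply/ffunP => v; rewrite !ffunE invgK.
split; first by rewrite (actsP (recolor_acts l m)).
by apply/exists_inP; exists (g^-1)%g; rewrite ?groupV.
Qed.

Lemma orbital_bichrom_Burnside l m :
  (orbital_bichrom G l m * #|G|)%N = (\sum_(g in G) bichrom (quotient_graph g) l m)%N.
Proof.
rewrite orbital_bichromE -(Frobenius_Cauchy (recolor_acts l m)).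
apply: eq_bigr => g _; rewrite -card_fixed_colorings; apply: eq_card => f.
rewrite !inE sub1set inE; congr (_ && _).
(* Being fixed by [g] and by its inverse are the same condition. *)
apply/eqP/forallP => [/ffunP fixf v | fixf].
  by have := fixf (g v); rewrite ffunE permK => ->.
by apply/ffunP => v; rewrite ffunE -[in RHS](permKV g v) (eqP (fixf _)).
Qed.

End Orbits.

Theorem theorem1 (Gm : mgraph) (G : {group {perm vertex Gm}})
    (hG : G \subset graph_aut Gm) :
  (forall l m : nat, (0 < l)%N -> (m <= l)%N ->
     (orbital_bichrom G l m)%:R
       = (#|G|%:R)^-1 * \sum_(g in G) (bichrom (quotient_graph g) l m)%:R :> rat)
  /\
  (exists p : {poly {poly rat}}, forall l m : nat, (0 < l)%N -> (m <= l)%N ->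
     (orbital_bichrom G l m)%:R = p.[l%:R, m%:R] :> rat).
Proof.
have burnside l m : (orbital_bichrom G l m)%:R
    = (#|G|%:R)^-1 * \sum_(g in G) (bichrom (quotient_graph g) l m)%:R :> rat.
  rewrite -natr_sum -orbital_bichrom_Burnside // natrM mulrC mulfK //.
  by rewrite Num.Theory.pnatr_eq0 -lt0n cardG_gt0.
split=> [l m _ _ //|].
have /fin_all_exists[p Hp] g := bichrom_polynomial (@quotient_graph Gm g).
exists ((#|G|%:R)^-1%:P%:P * \sum_(g in G) p g) => l m l0 lml.
rewrite burnside !hornerM !hornerC !horner_sum; congr (_ * _).
by apply: eq_bigr => g _; apply: Hp.
Qed.
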